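(* Let $f:[0,\infty)\to[0,\infty)$, let $\psi:\mathbb{R}\times\mathbb{R}\to\mathbb{R}$ be given by $\psi(x,t):=\operatorname{sign}(x-t)f(|x-t|)$, $x,t\in\mathbb{R}$, and let $\widetilde{f}:\mathbb{R}\to\mathbb{R}$ be the odd extension of $f$. If $f$ is continuous and strictly increasing with $f(0)=0$ and $\lim_{z\to\infty}f(z)\in(0,\infty)$, then, for any (real-valued) random variable $\xi$, we have that $\mathbb{E}(|\psi(\xi,t)|)<\infty$, $t\in\mathbb{R}$, and the equation $$\mathbb{E}(\psi(\xi,t))=\mathbb{E}(\widetilde{f}(\xi-t))=0$$ has a unique solution with respect to $t\in\mathbb{R}$.
   Context: $\operatorname{sign}(0)=0$. The odd extension $\widetilde{f}:\mathbb{R}\to\mathbb{R}$ of $f:[0,\infty)\to[0,\infty)$ is given by $\widetilde{f}(z):=f(z)$ if $z>0$, $\widetilde{f}(0):=0$, and $\widetilde{f}(z):=-f(-z)$ if $z<0$; thus $\psi(x,t)=\widetilde{f}(x-t)$. *)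

(* Defs.v *)
From HB Require Import structures.
From mathcomp Require Import all_boot all_order all_algebra.
From mathcomp Require Import all_classical all_reals all_analysis.

Set Implicit Arguments.
Unset Strict Implicit.
Unset Printing Implicit Defensive.

Import Order.TTheory GRing.Theory Num.Theory.
Import numFieldNormedType.Exports.

Local Open Scope ring_scope.

(* A function [0, oo) -> [0, oo) is represented by a total f : R -> R; only
   its values on [0, oo) are used below ([Num.sg 0 = 0]). *)

Definition psi (R : realType) (f : R -> R) (x t : R) : R :=
  Num.sg (x - t) * f `|x - t|.

Definition odd_ext (R : realType) (f : R -> R) (z : R) : R :=
  if 0 < z then f z else if z == 0 then 0 else - f (- z).

(* Main.v *)
Require Import Defs.
From HB Require Import structures.
From mathcomp Require Import all_boot all_order all_algebra.
From mathcomp Require Import all_classical all_reals all_analysis.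
From mathcomp Require Import measurable_realfun.
Import Order.TTheory GRing.Theory Num.Theory.
Import numFieldNormedType.Exports.
Local Open Scope classical_set_scope.
Local Open Scope ring_scope.

(** Write [g] for the odd extension of [f], so that [psi f x t = g (x - t)], and
    let [m t] be the expectation of [g (xi - t)]. Everything follows from four
    properties of [g]: it is continuous, it is strictly increasing, and with [l]
    the limit of [f] at infinity it is bounded by [l] and tends to [- l] and [l]
    at the two ends of the line.

    Boundedness makes [g (xi - t)] integrable for any [xi], so [m] is finite
    everywhere. The constant bound also dominates every sequence of shifts
    ([mean_shift_cvg]), so [m] inherits continuity and the limits [l] at minus
    infinity and [- l] at plus infinity. Hence [m] takes both signs, and the
    intermediate value theorem gives a zero ([mean_shift_root]). The zero is
    unique because [m] is strictly decreasing: for [s < t] the variable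
    [g (xi - s) - g (xi - t)] is positive at every outcome, and an everywhere
    positive variable has positive expectation ([integral_prob_gt0]). *)

(** * The odd extension *)

Section OddExtension.
Context {R : realType} (f : R -> R).
Hypothesis f_0 : f 0 = 0.

Lemma psiE (x t : R) : psi f x t = odd_ext f (x - t).
Proof.
rewrite /psi /odd_ext; case: ltgtP => [z0|z0|<-].
- by rewrite gtr0_sg// gtr0_norm// mul1r.
- by rewrite ltr0_sg// ltr0_norm// mulN1r.
- by rewrite sgr0 mul0r.
Qed.

Lemma odd_extN (z : R) : odd_ext f (- z) = - odd_ext f z.
Proof.
rewrite /odd_ext oppr_gt0 oppr_eq0 opprK.
by case: ltgtP => // _; rewrite ?opprK ?oppr0.
Qed.

Lemma odd_ext_ge0 (z : R) : 0 <= z -> odd_ext f z = f z.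
Proof. by rewrite /odd_ext; case: ltgtP => // <-; rewrite f_0. Qed.

(** The case distinction on the sign is absorbed by [max], so that continuity
    of the odd extension needs no separate study of the point [0]. *)
Lemma odd_ext_maxE (z : R) :
  odd_ext f z = f (Num.max z 0) - f (Num.max (- z) 0).
Proof.
have [z0|z0] := leP 0 z.
  by rewrite odd_ext_ge0// max_r ?oppr_le0// f_0 subr0.
rewrite -[in LHS](opprK z) odd_extN odd_ext_ge0 ?oppr_ge0 ?(ltW z0)//.
by rewrite max_l ?oppr_ge0 ?(ltW z0)// f_0 sub0r.
Qed.

Lemma odd_ext_continuous :
  {within `[0, +oo[, continuous f} -> continuous (odd_ext f).
Proof.
move=> /subspace_continuousP fc.
have fmaxc : continuous (fun z : R => f (Num.max z 0)).
  have max0 (z : R) : 0 <= Num.max z 0 by rewrite le_max lexx orbT.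
  move=> z; apply: (@cvg_comp _ _ _ (fun z => Num.max z 0) f) (fc _ _); last first.
    by rewrite /= in_itv/= andbT; exact: max0.
  have : {for z, continuous (fun z : R => Num.max z 0)}.
    apply: (@continuous_max _ _ (fun z : R => z) (fun=> 0)).
      exact: cvg_id.
    exact: cvg_cst.
  move=> maxc U AU; have := maxc _ AU; apply: (@filterS _ (nbhs z)) => y /=; apply.
  by rewrite in_itv/= andbT; exact: max0.
rewrite (_ : odd_ext f = fun z => f (Num.max z 0) - f (Num.max (- z) 0)).
  move=> z; apply: cvgB; first exact: fmaxc.
  apply: (@continuous_comp _ _ _ -%R (fun z : R => f (Num.max z 0))).
    exact: opp_continuous.
  exact: fmaxc.
by apply/funext => z; exact: odd_ext_maxE.
Qed.

Lemma odd_ext_increasing :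
  {in `[0, +oo[ &, {homo f : x y / x < y}} -> {homo odd_ext f : x y / x < y}.
Proof.
move=> finc.
have pos x y : 0 <= x -> x < y -> odd_ext f x < odd_ext f y.
  move=> x0 xy; have y0 : 0 <= y by rewrite ltW// (le_lt_trans x0).
  by rewrite !odd_ext_ge0//; apply: finc => //; rewrite in_itv/= andbT.
move=> x y xy; have [x0|x0] := leP 0 x; first exact: pos.
have [y0|y0] := leP y 0.
  (* both arguments on the left half-line: reflect them *)
  rewrite -[x]opprK -[y]opprK odd_extN (odd_extN (- y)) ltrN2.
  by apply: pos; rewrite ?oppr_ge0// ltrN2.
(* arguments of opposite signs: compare both with the value at 0 *)
apply: (@lt_trans _ _ (odd_ext f 0)); last exact: pos.
rewrite -[x]opprK -[0 in ltRHS]oppr0 odd_extN (odd_extN 0) ltrN2.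
by apply: pos => //; rewrite oppr_gt0.
Qed.

Lemma odd_ext_cvgy (l : R) :
  f z @[z --> +oo] --> l -> odd_ext f z @[z --> +oo] --> l.
Proof.
apply: cvg_trans; apply: near_eq_cvg; near=> z.
by rewrite odd_ext_ge0//; near: z; exact: nbhs_pinfty_ge.
Unshelve. all: by end_near. Qed.

Lemma odd_ext_cvgNy (l : R) :
  f z @[z --> +oo] --> l -> odd_ext f z @[z --> -oo] --> - l.
Proof.
move=> /odd_ext_cvgy fl; apply/cvgNy_compNP => /=.
by under eq_fun do rewrite odd_extN; exact: cvgN.
Qed.

(** An increasing function stays below its limit, so the limit itself is
    the bound on both half-lines. *)
Lemma odd_ext_bounded (l : R) :
  {in `[0, +oo[ &, {homo f : x y / x < y}} -> f z @[z --> +oo] --> l ->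
  forall z, `|odd_ext f z| <= l.
Proof.
move=> /odd_ext_increasing ginc /odd_ext_cvgy gl.
have ub z : odd_ext f z <= l.
  apply: (cvgr_to_ge gl); near=> y; apply/ltW/ginc.
  by near: y; exact: (nbhs_pinfty_gt (num_real z)).
by move=> z; rewrite ler_norml ub andbT lerNl -odd_extN ub.
Unshelve. all: by end_near. Qed.

End OddExtension.

(** * Positivity of expectations *)

(** If the expectation were [0], the variable would vanish almost surely,
    that is, the empty event would have probability [1]. *)
Lemma integral_prob_gt0 {R : realType} {d} {T : measurableType d}
    (P : probability T R) (X : T -> R) :
  measurable_fun setT X -> (forall w, 0 < X w) ->
  (0 < \int[P]_w (X w)%:E)%E.
Proof.
move=> mX X0; rewrite lt_neqAle integral_ge0 ?andbT; last first.
  by move=> w _; rewrite lee_fin ltW.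
apply/eqP => intX0.
have : ae_eq P setT (EFin \o X) (cst 0%E).
  apply/ae_eq_integral_abs => //; first exact/measurable_EFinP.
  rewrite intX0; apply: eq_integral => w _ /=.
  by rewrite gtr0_norm.
move=> [A [mA PA0 subA]].
have AT : A = setT.
  apply/seteqP; split => // w _; apply: subA => /= /(_ I) [] Xw0.
  by have := X0 w; rewrite Xw0 ltxx.
by have /eqP := probability_setT P; rewrite -AT [P A]PA0 eq_sym onee_eq0.
Qed.

(** * The mean as a function of the shift *)

Section MeanShift.
Context {R : realType} {d : measure_display} {T : measurableType d}.
Variables (P : probability T R) (xi : {RV P >-> R}) (g : R -> R).
Hypothesis g_cont : continuous g.

Lemma measurable_shift (t : R) : measurable_fun setT (fun w => g (xi w - t)).
Proof.
apply: measurableT_comp; first exact: continuous_measurable_fun.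
by apply: measurable_funB => //; exact: measurable_cst.
Qed.

Variable M : R.
Hypothesis g_bnd : forall z, `|g z| <= M.

Lemma integrable_shift (t : R) :
  P.-integrable setT (EFin \o (fun w => g (xi w - t))).
Proof.
apply: measurable_bounded_integrable => //.
- by rewrite [ltLHS]probability_setT ltry.
- exact: measurable_shift.
- by exists M; split; [exact: num_real|] => N MN w _; exact: le_trans (ltW MN).
Qed.

Definition mean_shift (t : R) : R := \int[P]_w g (xi w - t).

Lemma mean_shiftE (t : R) :
  (\int[P]_w (g (xi w - t))%:E)%E = (mean_shift t)%:E.
Proof.
by rewrite /mean_shift /Rintegral fineK//; apply: integrable_fin_num => //;
  exact: integrable_shift.
Qed.

(** Dominated convergence with the constant bound [M]. Taking [h] a translate
    of [g] gives continuity of the mean, and taking [h] constant gives its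
    limits at infinity. *)
Lemma mean_shift_cvg (u : nat -> R) (h : R -> R) :
  measurable_fun setT (h \o xi) ->
  (forall x, g (x - u n) @[n --> \oo] --> h x) ->
  mean_shift (u n) @[n --> \oo] --> \int[P]_w h (xi w).
Proof.
move=> mh gh.
have [|||||inth _] := @dominated_convergence _ _ _ P setT measurableT
  (fun n w => (g (xi w - u n))%:E) (fun w => (h (xi w))%:E) (cst M%:E).
- by move=> n; apply/measurable_EFinP; exact: measurable_shift.
- exact/measurable_EFinP.
- by apply: aeW => w _; apply: cvg_EFin; [exact: nearW|exact: gh].
- exact: finite_measure_integrable_cst.
- by apply: aeW => w n _; rewrite lee_fin.
move=> cvgI; apply: fine_cvg.
rewrite /Rintegral fineK//; exact: integrable_fin_num.
Qed.

Lemma mean_shift_continuous : continuous mean_shift.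
Proof.
move=> t; apply/(@cvg_nbhsP _ R^o) => u ut.
apply: (@mean_shift_cvg u (fun x => g (x - t))).
  exact: measurable_shift.
move=> x; apply: (@cvg_comp _ _ _ (fun n => x - u n) g); last exact: g_cont.
by apply: cvgB => //; exact: cvg_cst.
Qed.

Lemma mean_shift_cvg_cst (u : nat -> R) (c : R) :
  (forall x, g (x - u n) @[n --> \oo] --> c) ->
  mean_shift (u n) @[n --> \oo] --> c.
Proof.
move=> gc; have := @mean_shift_cvg u (fun=> c) (measurable_cst c) gc.
by rewrite Rintegral_cst// [X in fine X]probability_setT mulr1.
Qed.

Hypothesis g_inc : {homo g : x y / x < y}.

Lemma mean_shift_decreasing (s t : R) : s < t -> mean_shift t < mean_shift s.
Proof.
move=> st; rewrite -subr_gt0 -lte_fin -RintegralB//; try exact: integrable_shift.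
(* the strict inequality lives in the extended reals, hence finiteness first *)
rewrite /Rintegral fineK; last first.
  apply: integrable_fin_num => //.
  rewrite (_ : (fun _ => _) = (fun w => (g (xi w - s))%:E - (g (xi w - t))%:E))%E.
    by apply: integrableB => //; exact: integrable_shift.
  by apply/funext => w.
apply: integral_prob_gt0.
  by apply: measurable_funB; exact: measurable_shift.
by move=> w; rewrite subr_gt0; apply: g_inc; rewrite ltrD2l ltrN2.
Qed.

Variables a b : R.
Hypotheses (a_lt0 : a < 0) (b_gt0 : 0 < b).
Hypotheses (g_cvgNy : g z @[z --> -oo] --> a) (g_cvgy : g z @[z --> +oo] --> b).

(** Shifting by a large [t] pushes the mean to [a < 0], shifting by a large
    negative one pushes it to [b > 0]; in between it vanishes. *)
Lemma mean_shift_root : exists t, mean_shift t = 0.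
Proof.
have [p p0] : exists p, 0 < mean_shift p.
  have /cvgr_gt/(_ _ b_gt0) : mean_shift (- n%:R) @[n --> \oo] --> b.
    apply: mean_shift_cvg_cst => x; under eq_fun do rewrite opprK.
    apply: ((cvg_pinftyP g b).1 g_cvgy (fun n => x + n%:R)).
    exact: cvg_comp cvgr_idn (cvg_addrl x).
  by move=> [n _ /(_ n (leqnn n))]; exists (- n%:R).
have [q q0] : exists q, mean_shift q < 0.
  have /cvgr_lt/(_ _ a_lt0) : mean_shift n%:R @[n --> \oo] --> a.
    apply: mean_shift_cvg_cst => x.
    apply: ((cvg_ninftyP g a).1 g_cvgNy (fun n => x - n%:R)).
    apply: cvg_comp (cvg_addrl_Ny x); apply/cvgNry.
    rewrite [- _](_ : _ = (fun n => n%:R)); first exact: cvgr_idn.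
    by apply/funext => n; exact: opprK.
  by move=> [n _ /(_ n (leqnn n))]; exists n%:R.
have pq : p <= q.
  rewrite leNgt; apply/negP => /mean_shift_decreasing.
  by rewrite ltNge (ltW (lt_trans q0 p0)).
have [||t _ t0] := @IVT R mean_shift p q 0 pq; last by exists t.
- by apply: continuous_subspaceT; exact: mean_shift_continuous.
- by rewrite ge_min le_max (ltW p0) (ltW q0) orbT.
Qed.

Lemma mean_shift_unique_root : exists! t, mean_shift t = 0.
Proof.
have [t t0] := mean_shift_root; exists t; split => // s s0.
by case: (ltgtP t s) => // /mean_shift_decreasing; rewrite t0 s0 ltxx.
Qed.

End MeanShift.

(** * Existence and uniqueness of the solution *)

Theorem proposition3p7 (R : realType) (f : R -> R)
    (f_ge0 : forall z : R, 0 <= z -> 0 <= f z)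
    (f_cont : {within `[0, +oo[, continuous f})
    (f_incr : {in `[0, +oo[ &, {homo f : x y / x < y}})
    (f_0 : f 0 = 0)
    (f_lim : exists2 l : R, 0 < l & f z @[z --> +oo] --> l)
    (d : measure_display) (T : measurableType d) (P : probability T R)
    (xi : {RV P >-> R}) :
  (forall t : R,
     measurable_fun [set: T] (fun w => psi f (xi w) t) /\
     ('E_P[fun w => (`|psi f (xi w) t|)%R] < +oo)%E) /\
  (forall t : R,
     'E_P[fun w => psi f (xi w) t]%E = 'E_P[fun w => odd_ext f (xi w - t)]%E) /\
  (exists! t : R, 'E_P[fun w => psi f (xi w) t]%E = 0%E).
Proof.
have [l l0 fl] := f_lim.
have gc := odd_ext_continuous f f_0 f_cont.
have gb := odd_ext_bounded f f_0 l f_incr fl.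
have psiS t : (fun w => psi f (xi w) t) = (fun w => odd_ext f (xi w - t)).
  by apply/funext => w; exact: psiE.
split=> [t|]; last split=> [t|]; rewrite ?psiS//.
  split; first exact: measurable_shift.
  under [fun w => `|_|]eq_fun do rewrite psiE.
  have /integrableP[_] := integrable_shift P xi _ gc _ gb t.
  by rewrite unlock.
have Nl0 : - l < 0 by rewrite oppr_lt0.
have [t [t0 tU]] := mean_shift_unique_root P xi _ gc _ gb
  (odd_ext_increasing f f_0 f_incr) _ _ Nl0 l0
  (odd_ext_cvgNy f f_0 _ fl) (odd_ext_cvgy f f_0 _ fl).
have EE s : 'E_P[fun w => psi f (xi w) s]%E = (mean_shift P xi (odd_ext f) s)%:E.
  by rewrite psiS unlock (mean_shiftE _ _ _ gc _ gb).
exists t; split; first by rewrite EE t0.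
by move=> s; rewrite EE => -[] /tU.
Qed.
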